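(* Let $\lambda\in\mathbb{R}$. For all integers $m,n\ge 0$ and every real $x$, \[ \sum_{k=0}^{m}S_{2,\lambda}(m,k)\,(k)_{n,\lambda}\,x^{k} =\sum_{k=0}^{n}\sum_{j=0}^{n-k}\binom{n}{k}\binom{n-k}{j}\mathrm{Bel}_{m+k,\lambda}(x)\,\mathrm{Bel}_{n-k-j,\lambda}(-x)\,(m\lambda)_{j,\lambda}. \]
   Context: For $\lambda\in\mathbb{R}$, $(x)_{0,\lambda}=1$ and $(x)_{n,\lambda}=x(x-\lambda)\cdots(x-(n-1)\lambda)$ for $n\ge1$; $(x)_0=1$ and $(x)_n=x(x-1)\cdots(x-n+1)$. The degenerate Stirling numbers of the second kind $S_{2,\lambda}(n,k)$ are defined by $(x)_{n,\lambda}=\sum_{k=0}^{n}S_{2,\lambda}(n,k)(x)_{k}$. The degenerate exponential is $e_\lambda(t)=\sum_{k\ge0}(1)_{k,\lambda}t^k/k!$, and the degenerate Bell polynomials are defined by $e^{x(e_{\lambda}(t)-1)}=\sum_{n=0}^{\infty}\mathrm{Bel}_{n,\lambda}(x)\frac{t^{n}}{n!}$ (equivalently $\mathrm{Bel}_{n,\lambda}(x)=\sum_{k=0}^nS_{2,\lambda}(n,k)x^k$). *)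

(* Defs.v *)
(* [R : realType] stands for the field of real numbers. *)
From mathcomp Require Import all_boot all_order all_algebra.
From mathcomp Require Import boolp reals.
From mathcomp Require Import ring.
Set Implicit Arguments.
Unset Strict Implicit.
Unset Printing Implicit Defensive.
Import Order.TTheory GRing.Theory Num.Theory.
Local Open Scope ring_scope.

Definition ffactr (R : realType) (y : R) (n : nat) : R :=
  \prod_(i < n) (y - i%:R).

Definition deg_ffactr (R : realType) (lam y : R) (n : nat) : R :=
  \prod_(i < n) (y - i%:R * lam).

Definition is_deg_stirling2 (R : realType) (lam : R) (S : nat -> nat -> R) : Prop :=
  forall (n : nat) (y : R),
    deg_ffactr lam y n = \sum_(k < n.+1) S n k * ffactr y k.

Lemma deg_stirling2_exists (R : realType) (lam : R) :
  exists S : nat -> nat -> R, is_deg_stirling2 lam S.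
Proof.
pose F := fix F (n k : nat) : R := match n with
  | 0 => (k == 0%N)%:R
  | n'.+1 => (if k is k'.+1 then F n' k' else 0) + (k%:R - n'%:R * lam) * F n' k
  end.
have F0 n k : (n < k)%N -> F n k = 0.
  elim: n k => [|n IH] [|k] //= nk.
  by rewrite IH // IH ?mulr0 ?addr0 // ltnW.
exists F => n y; elim: n => [|n IH].
  by rewrite /deg_ffactr big_ord0 big_ord_recl big_ord0 /ffactr big_ord0 /= addr0 mulr1.
rewrite /deg_ffactr big_ord_recr /= -/(deg_ffactr lam y n) IH.
under [RHS]eq_bigr => k _ do rewrite mulrDl.
rewrite [RHS]big_split /= [X in _ = X + _]big_ord_recl /= mul0r add0r.
rewrite [X in _ = _ + X]big_ord_recr /= (F0 n n.+1) // mulr0 mul0r addr0.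
rewrite -big_split /= mulr_suml; apply: eq_bigr => k _.
rewrite /bump /= add1n [in RHS]/ffactr big_ord_recr /= -/(ffactr y k).
by ring.
Qed.

(* The defining identities determine [S n k] for [k <= n], as the falling
   factorials are linearly independent; the values for [n < k] are arbitrary. *)
Definition deg_stirling2 (R : realType) (lam : R) : nat -> nat -> R :=
  sval (cid (deg_stirling2_exists lam)).

Lemma deg_stirling2P (R : realType) (lam : R) :
  is_deg_stirling2 lam (deg_stirling2 lam).
Proof. exact: svalP (cid (deg_stirling2_exists lam)). Qed.

(* A formal power series in [t] is the sequence of its ordinary coefficients:
   [f k] is the coefficient of [t ^ k]. *)
Definition fps (R : realType) := nat -> R.

Definition fps_one (R : realType) : fps R := fun n => (n == 0%N)%:R.

Definition fps_mul (R : realType) (f g : fps R) : fps R :=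
  fun n => \sum_(i < n.+1) f i * g (n - i)%N.

Definition fps_pow (R : realType) (f : fps R) (k : nat) : fps R :=
  iter k (fps_mul f) (fps_one R).

(* [exp f = \sum_k f ^ k / k!] for a series [f] without constant term: [f ^ k]
   is then divisible by [t ^ k], so only the terms with [k <= n] contribute to
   the coefficient of [t ^ n]. *)
Definition fps_exp (R : realType) (f : fps R) : fps R :=
  fun n => \sum_(k < n.+1) fps_pow f k n / k`!%:R.

Definition deg_exp (R : realType) (lam : R) : fps R :=
  fun k => deg_ffactr lam 1 k / k`!%:R.

(* [n!] times the coefficient of [t ^ n] in [exp (x (e_lam(t) - 1))]; the
   series [e_lam(t) - 1] has no constant term since [(1)_{0,lam} / 0! = 1]. *)
Definition deg_bell (R : realType) (lam : R) (n : nat) (x : R) : R :=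
  n`!%:R * fps_exp (fun k => x * (deg_exp lam k - fps_one R k)) n.

(* Main.v *)
Require Import Defs.
From HB Require Import structures.
From mathcomp Require Import all_boot all_order all_algebra.
From mathcomp Require Import boolp reals.
From mathcomp Require Import ring zify.
Set Implicit Arguments.
Unset Strict Implicit.
Unset Printing Implicit Defensive.
Import Order.TTheory GRing.Theory Num.Theory.
Local Open Scope ring_scope.

(* Let theta = (1 + lam t) d/dt and B = exp (x (e_lam - 1)).  The power
   e_lam ^ a, with coefficients (a)_{n,lam} / n!, is the eigenvector of theta
   with eigenvalue a and constant term 1.  In particular
   (1 + lam t) ^ m = e_lam ^ (m lam), so the right-hand side of the theorem is
   n! times the coefficient of t ^ n in ((1 + lam t) ^ m B^(m)) / B.  As
   (1 + lam t) ^ m D ^ m = theta (theta - lam) ... (theta - (m - 1) lam) and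
   theta B = x e_lam B, this quotient is sum_k S(m, k) x ^ k e_lam ^ k, because
   both sides obey the recurrence of the degenerate Stirling numbers. *)

(** * Formal power series as a commutative ring with a derivation *)

HB.instance Definition _ (R : realType) := gen_eqMixin (fps R).
HB.instance Definition _ (R : realType) := gen_choiceMixin (fps R).

Section FpsRing.
Variable R : realType.
Implicit Types f g h : fps R.

Definition fps_zero : fps R := fun=> 0.
Definition fps_opp f : fps R := fun n => - f n.
Definition fps_add f g : fps R := fun n => f n + g n.

Lemma fps_addA : associative fps_add.
Proof. by move=> f g h; apply/funext=> n; exact: addrA. Qed.
Lemma fps_addC : commutative fps_add.
Proof. by move=> f g; apply/funext=> n; exact: addrC. Qed.
Lemma fps_add0 : left_id fps_zero fps_add.
Proof. by move=> f; apply/funext=> n; exact: add0r. Qed.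
Lemma fps_addN : left_inverse fps_zero fps_opp fps_add.
Proof. by move=> f; apply/funext=> n; exact: addNr. Qed.

HB.instance Definition _ :=
  GRing.isZmodule.Build (fps R) fps_addA fps_addC fps_add0 fps_addN.

(** A coefficient of a product depends only on coefficients of the factors up to the same degree, so
    identities for series can be read off from polynomials. *)
Definition fps_trunc N f : {poly R} := \poly_(i < N.+1) f i.

Lemma coef_fps_trunc N f n : (n <= N)%N -> (fps_trunc N f)`_n = f n.
Proof. by move=> nN; rewrite coef_poly ltnS nN. Qed.

Lemma fps_mul_trunc N f g n : (n <= N)%N ->
  fps_mul f g n = (fps_trunc N f * fps_trunc N g)`_n.
Proof.
move=> nN; rewrite coefM; apply: eq_bigr => i _.
by rewrite !coef_fps_trunc //; have := ltn_ord i; lia.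
Qed.

Lemma fps_mulA : associative (@fps_mul R).
Proof.
move=> f g h; apply/funext=> n.
transitivity (fps_trunc n f * (fps_trunc n g * fps_trunc n h))`_n.
  rewrite coefM; apply: eq_bigr => i _.
  by rewrite (@fps_mul_trunc n) ?leq_subr // coef_fps_trunc // -ltnS.
rewrite mulrA coefM; apply: eq_bigr => i _.
rewrite (@fps_mul_trunc n) ?coef_fps_trunc ?leq_subr //.
by rewrite -ltnS.
Qed.

Lemma fps_mulC : commutative (@fps_mul R).
Proof. by move=> f g; apply/funext=> n; rewrite !(@fps_mul_trunc n) // mulrC. Qed.

Lemma fps_mul1 : left_id (@fps_one R) (@fps_mul R).
Proof.
move=> f; apply/funext=> n; rewrite /fps_mul big_ord_recl /= /fps_one subn0.
by rewrite mul1r big1 ?addr0 // => i _; rewrite mul0r.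
Qed.

Lemma fps_mulDl : left_distributive (@fps_mul R) fps_add.
Proof.
move=> f g h; apply/funext=> n; rewrite /fps_mul /fps_add -big_split /=.
by apply: eq_bigr => i _; rewrite mulrDl.
Qed.

HB.instance Definition _ := GRing.Zmodule_isComPzRing.Build (fps R)
  fps_mulA fps_mulC fps_mul1 fps_mulDl.

Lemma fps_addE f g n : (f + g) n = f n + g n. Proof. by []. Qed.
Lemma fps_mulE f g n : (f * g) n = \sum_(i < n.+1) f i * g (n - i)%N.
Proof. by []. Qed.
Lemma fps_oneE n : (1 : fps R) n = (n == 0%N)%:R. Proof. by []. Qed.
Lemma fps_powE f k : fps_pow f k = f ^+ k.
Proof. by elim: k => [|k IH] //; rewrite exprS -IH. Qed.

Lemma fps_sumE (I : Type) (r : seq I) (F : I -> fps R) n :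
  (\sum_(i <- r) F i) n = \sum_(i <- r) F i n.
Proof.
by elim: r => [|i r IH]; rewrite ?big_nil // !big_cons fps_addE IH.
Qed.

Definition fps_const (c : R) : fps R := fun n => if n is 0 then c else 0.

Lemma fps_constM c f n : (fps_const c * f) n = c * f n.
Proof.
rewrite fps_mulE big_ord_recl subn0 big1 ?addr0 // => i _.
by rewrite mul0r.
Qed.

Lemma fps_const_is_zmod_morphism : zmod_morphism fps_const.
Proof. by move=> a b; apply/funext=> -[|n] //; apply/esym/subr0. Qed.

Lemma fps_const_is_monoid_morphism : monoid_morphism fps_const.
Proof.
split; first by apply/funext=> -[|n].
by move=> a b; apply/funext=> -[|n]; rewrite fps_constM ?mulr0.
Qed.

HB.instance Definition _ :=
  GRing.isZmodMorphism.Build R (fps R) fps_const fps_const_is_zmod_morphism.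
HB.instance Definition _ :=
  GRing.isMonoidMorphism.Build R (fps R) fps_const fps_const_is_monoid_morphism.

Definition fps_deriv f : fps R := fun n => n.+1%:R * f n.+1.

Lemma fps_deriv_is_zmod_morphism : zmod_morphism fps_deriv.
Proof. by move=> f g; apply/funext=> n; exact: mulrBr. Qed.

HB.instance Definition _ :=
  GRing.isZmodMorphism.Build (fps R) (fps R) fps_deriv fps_deriv_is_zmod_morphism.

Lemma fps_derivM f g : fps_deriv (f * g) = fps_deriv f * g + f * fps_deriv g.
Proof.
apply/funext=> n; rewrite /fps_deriv.
(* The truncation degree is [n.+1], as the derivative moves that coefficient down to [n]. *)
have -> : (f * g) n.+1 = (fps_trunc n.+1 f * fps_trunc n.+1 g)`_n.+1.
  exact: fps_mul_trunc.
rewrite mulr_natl -coef_deriv derivM coefD !coefM fps_addE !fps_mulE.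
congr (_ + _); apply: eq_bigr => i _; have iN := ltn_ord i;
  rewrite coef_deriv !coef_fps_trunc ?mulr_natl //; lia.
Qed.

Lemma fps_deriv_const c f : fps_deriv (fps_const c * f) = fps_const c * fps_deriv f.
Proof. by apply/funext=> n; rewrite /fps_deriv !fps_constM mulrCA. Qed.

Lemma fps_derivX f k :
  fps_deriv (f ^+ k.+1) = fps_const k.+1%:R * (fps_deriv f * f ^+ k).
Proof.
elim: k => [|k IH]; first by rewrite expr1 expr0 rmorph1; ring.
by rewrite exprS fps_derivM IH -[k.+2]addn1 natrD rmorphD rmorph1 !exprS; ring.
Qed.

(** Differentiation shifts the sequence of exponential coefficients; this is how the index $m+k$ of
    the Bell polynomials arises. *)
Lemma iter_fps_deriv m f n :
  n`!%:R * iter m fps_deriv f n = (m + n)`!%:R * f (m + n)%N.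
Proof.
elim: m n => [|m IH] n //=; rewrite /fps_deriv mulrA -natrM mulnC -factS IH.
by rewrite addnS addSn.
Qed.

Lemma fps_deriv_inj f g : fps_deriv f = fps_deriv g -> f 0 = g 0 -> f = g.
Proof.
move=> Dfg fg0; apply/funext=> -[//|n].
have /(congr1 (fun h : fps R => h n)) := Dfg.
by apply: mulfI; rewrite pnatr_eq0.
Qed.

End FpsRing.

(** * The exponential of a series without constant term *)

Section FpsExp.
Variable R : realType.
Implicit Types f g : fps R.

Lemma fps_exp_eq0 f k n : f 0 = 0 -> (n < k)%N -> (f ^+ k) n = 0.
Proof.
move=> f0; elim: k n => [|k IH] n // nk.
rewrite exprS fps_mulE big_ord_recl f0 mul0r add0r big1 // => i _.
by rewrite IH ?mulr0 //= /bump; have := ltn_ord i; move: nk => /=; lia.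
Qed.

(** A bound [N] common to several coefficients makes it possible to differentiate term by term and
    to exchange sums. *)
Lemma fps_expE N f n : f 0 = 0 -> (n <= N)%N ->
  fps_exp f n = \sum_(k < N.+1) (f ^+ k) n / k`!%:R.
Proof.
move=> f0 nN; rewrite /fps_exp.
rewrite -(big_mkord xpredT (fun k => fps_pow f k n / k`!%:R)).
rewrite -(big_mkord xpredT (fun k => (f ^+ k) n / k`!%:R)).
rewrite [RHS](big_cat_nat (n := n.+1)) //= [X in _ + X]big_nat_cond.
rewrite [X in _ = _ + X]big1 ?addr0; last first.
  by move=> k /andP[/andP[nk _] _]; rewrite fps_exp_eq0 // mul0r.
by apply: eq_bigr => k _; rewrite fps_powE.
Qed.

Lemma fps_exp0 f : fps_exp f 0 = 1.
Proof. by rewrite /fps_exp big_ord_recl big_ord0 /= fact0 divr1 addr0. Qed.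

Lemma fps_deriv_exp f : f 0 = 0 -> fps_deriv (fps_exp f) = fps_deriv f * fps_exp f.
Proof.
move=> f0; apply/funext=> n.
rewrite {1}/fps_deriv (fps_expE f0 (leqnn n.+1)) big_ord_recl.
rewrite [X in X / _]fps_oneE mul0r add0r mulr_sumr fps_mulE.
under [RHS]eq_bigr => i _ do rewrite (fps_expE f0 (leq_subr i n)) mulr_sumr.
rewrite exchange_big /=; apply: eq_bigr => k _.
(* The factor $k+1$ coming from the derivative of $f^{k+1}$ turns $1/(k+1)!$ into $1/k!$. *)
rewrite mulrA -[n.+1%:R * _]/(fps_deriv (f ^+ k.+1) n) fps_derivX fps_constM.
rewrite factS natrM fps_mulE mulr_sumr mulr_suml; apply: eq_bigr => i _.
by field; rewrite nat1r !pnatr_eq0 -lt0n fact_gt0.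
Qed.

(** The product has derivative $(f'+g')\exp(f)\exp(g)=0$ and constant term 1. *)
Lemma fps_expN f g : f 0 = 0 -> f + g = 0 -> fps_exp f * fps_exp g = 1.
Proof.
move=> f0 fg; have gE : g = - f by apply/eqP; rewrite -addr_eq0 addrC fg.
have g0 : g 0 = 0 by rewrite gE -[LHS]/(- f 0) f0 oppr0.
apply: fps_deriv_inj; last first.
  by rewrite fps_mulE big_ord_recl big_ord0 !fps_exp0 fps_oneE mulr1 addr0.
rewrite fps_derivM !fps_deriv_exp // gE raddfN /=.
transitivity (0 : fps R); first by ring.
by apply/funext=> n; apply/esym/mulr0.
Qed.

End FpsExp.

(** * Powers of the degenerate exponential and the operator [theta] *)

Section DegExp.
Variables (R : realType) (lam : R).
Implicit Types (f g : fps R) (a b : R).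

(* The series [e_lam(t) ^ a]. *)
Definition deg_exp_pow a : fps R := fun n => deg_ffactr lam a n / n`!%:R.

Local Notation E := deg_exp_pow.

(* [E lam] is [1 + lam t]. *)
Definition theta f : fps R := E lam * fps_deriv f.

Lemma deg_ffactrS a n :
  deg_ffactr lam a n.+1 = deg_ffactr lam a n * (a - n%:R * lam).
Proof. exact: big_ord_recr. Qed.

Lemma deg_exp_pow0 a : E a 0 = 1.
Proof. by rewrite /E /deg_ffactr big_ord0 fact0 divr1. Qed.

Lemma deg_exp_powS a n : n.+1%:R * E a n.+1 = (a - n%:R * lam) * E a n.
Proof.
rewrite /E deg_ffactrS factS natrM; field.
by rewrite nat1r !pnatr_eq0 -lt0n fact_gt0.
Qed.

Lemma deg_exp_pow_lam n : E lam n.+2 = 0.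
Proof.
(* The factor of index 1 is $\lambda-1\cdot\lambda=0$. *)
rewrite /E /deg_ffactr (bigD1 (Ordinal (isT : (1 < n.+2)%N))) //=.
by rewrite mul1r subrr !mul0r.
Qed.

Lemma thetaE f n : theta f n = n.+1%:R * f n.+1 + n%:R * lam * f n.
Proof.
rewrite /theta fps_mulE big_ord_recl subn0 deg_exp_pow0 mul1r /fps_deriv.
congr (_ + _); case: n => [|n]; first by rewrite big_ord0 !mul0r.
rewrite big_ord_recl big1 ?addr0; last first.
  by move=> i _; rewrite deg_exp_pow_lam mul0r.
have := deg_exp_powS lam 0; rewrite deg_exp_pow0 mul1r mul0r subr0 mulr1 => ->.
by rewrite subSS subn0; ring.
Qed.

Lemma thetaM f g : theta (f * g) = theta f * g + f * theta g.
Proof. by rewrite /theta fps_derivM; ring. Qed.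

Lemma theta_is_zmod_morphism : zmod_morphism theta.
Proof. by move=> f g; rewrite /theta raddfB /=; ring. Qed.

HB.instance Definition _ :=
  GRing.isZmodMorphism.Build (fps R) (fps R) theta theta_is_zmod_morphism.

Lemma theta_const c f : theta (fps_const c * f) = fps_const c * theta f.
Proof. by rewrite /theta fps_deriv_const; ring. Qed.

Lemma theta_deg_exp_pow a : theta (E a) = fps_const a * E a.
Proof.
by apply/funext=> n; rewrite thetaE deg_exp_powS fps_constM; ring.
Qed.

(** The eigenvalue equation reads $(n+1)f_{n+1}=(a-n\lambda)f_n$, so the constant term determines
    all coefficients. *)
Lemma theta_eigen_unique a f g : theta f = fps_const a * f ->
  theta g = fps_const a * g -> f 0 = g 0 -> f = g.
Proof.
move=> tf tg fg0; apply/funext; elim=> [//|n IH].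
have /(congr1 (fun h : fps R => h n)) := tf.
have /(congr1 (fun h : fps R => h n)) := tg.
rewrite !thetaE !fps_constM IH => <- /addIr.
by apply: mulfI; rewrite pnatr_eq0.
Qed.

(** As [theta] is a derivation, the eigenvalues of the two factors add up. *)
Lemma deg_exp_powD a b : E (a + b) = E a * E b.
Proof.
apply: (@theta_eigen_unique (a + b)); first exact: theta_deg_exp_pow.
  by rewrite thetaM !theta_deg_exp_pow rmorphD /=; ring.
by rewrite fps_mulE big_ord_recl big_ord0 !deg_exp_pow0 mulr1 addr0.
Qed.

Lemma deg_exp_pow_0 : E 0 = 1.
Proof.
apply: (@theta_eigen_unique 0); first exact: theta_deg_exp_pow.
  rewrite rmorph0 mul0r; apply/funext=> -[|n]; rewrite thetaE !fps_oneE /=.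
    by rewrite mulr0 !mul0r addr0.
  by rewrite !mulr0 addr0.
by rewrite deg_exp_pow0.
Qed.

(** The exponential generating function of [deg_bell], called $B$ above. *)
Definition bell_series (x : R) : fps R :=
  fps_exp (fun k => x * (deg_exp lam k - fps_one R k)).

Lemma bell_series_argE x :
  (fun k => x * (deg_exp lam k - fps_one R k)) = fps_const x * (E 1 - 1) :> fps R.
Proof. by apply/funext=> n; rewrite fps_constM. Qed.

Lemma bell_series_arg0 x : (fps_const x * (E 1 - 1)) 0 = 0 :> R.
Proof.
by rewrite fps_constM -[(E 1 - 1) 0]/(E 1 0 - 1) deg_exp_pow0 subrr mulr0.
Qed.

Lemma theta_bell_series x :
  theta (bell_series x) = fps_const x * E 1 * bell_series x.
Proof.
have theta1 : theta 1 = 0.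
  by rewrite -deg_exp_pow_0 theta_deg_exp_pow rmorph0 mul0r.
rewrite /bell_series bell_series_argE {1}/theta.
rewrite fps_deriv_exp ?bell_series_arg0 // mulrA.
rewrite -[E lam * _]/(theta _) theta_const raddfB /= theta_deg_exp_pow.
by rewrite theta1 rmorph1; ring.
Qed.

Lemma bell_seriesN x : bell_series x * bell_series (- x) = 1.
Proof.
rewrite /bell_series !bell_series_argE; apply: fps_expN.
  exact: bell_series_arg0.
by rewrite rmorphN /=; ring.
Qed.

(** One step of the factorization of $(1+\lambda t)^mD^m$: by the product rule, subtracting
    $m\lambda$ cancels the term in which [theta] hits $(1+\lambda t)^m$. *)
Lemma deriv_bell_theta f m :
  E (m.+1%:R * lam) * iter m.+1 (@fps_deriv R) f =
  theta (E (m%:R * lam) * iter m (@fps_deriv R) f)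
  - fps_const (m%:R * lam) * (E (m%:R * lam) * iter m (@fps_deriv R) f).
Proof.
rewrite thetaM theta_deg_exp_pow -natr1 mulrDl mul1r deg_exp_powD /theta /=.
by ring.
Qed.

End DegExp.

(** * The Stirling recurrence and its generating series *)

Section Stirling.
Variables (R : realType) (lam : R).

Local Notation S := (deg_stirling2 lam).
Local Notation E := (deg_exp_pow lam).

Lemma ffactrS (y : R) n : ffactr y n.+1 = ffactr y n * (y - n%:R).
Proof. exact: big_ord_recr. Qed.

Lemma ffactr_gt (i k : nat) : (i < k)%N -> ffactr (i%:R : R) k = 0.
Proof.
by move=> ik; rewrite /ffactr (bigD1 (Ordinal ik)) //= subrr mul0r.
Qed.

Lemma ffactr_id_neq0 (i : nat) : ffactr (i%:R : R) i != 0.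
Proof.
apply/prodf_neq0 => k _; rewrite subr_eq0 eqr_nat.
by have := ltn_ord k; lia.
Qed.

(** Evaluation at $y=0,1,2,\dots$ gives a triangular system with nonzero diagonal. *)
Lemma ffactr_free N (c : nat -> R) :
  (forall y, \sum_(k < N) c k * ffactr y k = 0) -> forall k, (k < N)%N -> c k = 0.
Proof.
move=> c0; elim/ltn_ind => i IH iN; have := c0 i%:R.
rewrite (bigD1 (Ordinal iN)) //= big1 ?addr0.
  by move/eqP; rewrite mulf_eq0 (negPf (ffactr_id_neq0 _)) orbF => /eqP.
move=> k; rewrite -val_eqE /= neq_ltn => /orP[ki|ik].
  by rewrite IH ?mul0r //; exact: ltn_trans ki iN.
by rewrite ffactr_gt ?mulr0.
Qed.

Lemma deg_stirling2_00 : S 0 0 = 1.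
Proof.
have := deg_stirling2P lam 0 0.
by rewrite big_ord_recl big_ord0 /ffactr /deg_ffactr !big_ord0 mulr1 addr0.
Qed.

(** The recurrence $S(m+1,k)=S(m,k-1)+(k-m\lambda)S(m,k)$, summed against arbitrary weights so that
    no value outside the triangle appears. *)
Lemma deg_stirling2_rec m (v : nat -> R) :
  \sum_(k < m.+2) S m.+1 k * v k =
  \sum_(k < m.+1) S m k * (v k.+1 + (k%:R - m%:R * lam) * v k).
Proof.
(* The guard [k <= m] replaces the unspecified value [S m m.+1] by 0. *)
pose d k := (if k is k'.+1 then S m k' else 0)
            + (if (k <= m)%N then (k%:R - m%:R * lam) * S m k else 0).
have sumd (w : nat -> R) : \sum_(k < m.+2) d k * w k =
    \sum_(k < m.+1) S m k * (w k.+1 + (k%:R - m%:R * lam) * w k).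
  under eq_bigr => k _ do rewrite mulrDl.
  rewrite big_split /= [X in X + _]big_ord_recl mul0r add0r.
  rewrite [X in _ + X]big_ord_recr /= ltnn mul0r addr0 -big_split /=.
  by apply: eq_bigr => k _; rewrite -ltnS ltn_ord /bump /= add1n; ring.
rewrite -sumd; apply: eq_bigr => k _; congr (_ * _).
apply/eqP; rewrite -subr_eq0; apply/eqP.
(* With falling factorials as weights, both sides expand $(y)_{m+1,\lambda}$, since
   $(y)_k(y-m\lambda)=(y)_{k+1}+(k-m\lambda)(y)_k$. *)
apply: (@ffactr_free m.+2 (fun k => S m.+1 k - d k)) => // y.
under eq_bigr => i _ do rewrite mulrBl.
rewrite sumrB -(deg_stirling2P lam m.+1) sumd deg_ffactrS.
rewrite (deg_stirling2P lam m) mulr_suml -sumrB big1 // => i _.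
by rewrite ffactrS; ring.
Qed.

(** This is $\sum_k S(m,k)(x e_\lambda)^k$; its exponential coefficients form the left-hand side of
    the theorem. *)
Definition stirling_series (x : R) m : fps R :=
  \sum_(k < m.+1) fps_const (S m k * x ^+ k) * E k%:R.

Lemma stirling_seriesE x m n :
  stirling_series x m n = \sum_(k < m.+1) S m k * (x ^+ k * E k%:R n).
Proof. by rewrite /stirling_series fps_sumE; apply: eq_bigr => k _; rewrite fps_constM mulrA. Qed.

Lemma stirling_series0 x : stirling_series x 0 = 1.
Proof.
rewrite /stirling_series big_ord_recl big_ord0 /= deg_stirling2_00.
by rewrite mulr1 rmorph1 deg_exp_pow_0 mulr1 addr0.
Qed.

Lemma stirling_series_rec x m :
  stirling_series x m.+1 = fps_const x * E 1 * stirling_series x m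
  + theta lam (stirling_series x m) - fps_const (m%:R * lam) * stirling_series x m.
Proof.
rewrite /(stirling_series x m) raddf_sum !mulr_sumr -big_split -sumrB /=.
apply/funext=> n.
rewrite stirling_seriesE (deg_stirling2_rec m (fun k => x ^+ k * E k%:R n)).
rewrite fps_sumE; apply: eq_bigr => k _.
rewrite theta_const theta_deg_exp_pow.
set c := fps_const (S m k * x ^+ k).
have -> : fps_const x * E 1 * (c * E k%:R) + c * (fps_const k%:R * E k%:R)
    - fps_const (m%:R * lam) * (c * E k%:R)
  = c * (fps_const x * E k.+1%:R + fps_const (k%:R - m%:R * lam) * E k%:R).
  by rewrite -natr1 deg_exp_powD rmorphB /=; ring.
by rewrite fps_constM fps_addE !fps_constM exprS; ring.
Qed.

(** Applying [theta] to $B\cdot F$ gives $B\,(x e_\lambda F+\theta F)$, so after subtracting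
    $m\lambda$ the cofactor of $B$ follows [stirling_series_rec]. *)
Lemma iter_deriv_bell_series x m :
  E (m%:R * lam) * iter m (@fps_deriv R) (bell_series lam x)
  = bell_series lam x * stirling_series x m.
Proof.
elim: m => [|m IH].
  by rewrite mul0r deg_exp_pow_0 stirling_series0 mul1r mulr1.
rewrite deriv_bell_theta IH thetaM theta_bell_series stirling_series_rec.
by ring.
Qed.

End Stirling.

Theorem theorem13 (R : realType) (lam : R) (m n : nat) (x : R) :
  \sum_(k < m.+1) deg_stirling2 lam m k * deg_ffactr lam k%:R n * x ^+ k
  = \sum_(k < n.+1) \sum_(j < (n - k).+1)
      'C(n, k)%:R * 'C(n - k, j)%:R * deg_bell lam (m + k) x
      * deg_bell lam (n - k - j) (- x) * deg_ffactr lam (m%:R * lam) j.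
Proof.
have fact_neq0 i : i`!%:R != 0 :> R by rewrite pnatr_eq0 -lt0n fact_gt0.
have fact_deg_exp_pow a i : deg_ffactr lam a i = i`!%:R * deg_exp_pow lam a i.
  by rewrite mulrC divfK.
transitivity (n`!%:R * stirling_series lam x m n).
  rewrite stirling_seriesE mulr_sumr; apply: eq_bigr => k _.
  by rewrite fact_deg_exp_pow; ring.
(* Division by $B$ is multiplication by the Bell series at $-x$. The three factors yield the double
   sum. *)
have -> : stirling_series lam x m =
    iter m (@fps_deriv R) (bell_series lam x)
    * (deg_exp_pow lam (m%:R * lam) * bell_series lam (- x)).
  rewrite mulrA [_ * deg_exp_pow _ _]mulrC iter_deriv_bell_series.
  by rewrite mulrAC bell_seriesN mul1r.
rewrite fps_mulE mulr_sumr; apply: eq_bigr => k _.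
rewrite fps_mulE !mulr_sumr; apply: eq_bigr => j _.
have kn : (k <= n)%N by rewrite -ltnS.
have jn : (j <= n - k)%N by rewrite -ltnS.
(* Splitting $n!$ into the two binomials and $k!\,j!\,(n-k-j)!$ gives each factor its own
   factorial. *)
rewrite -(bin_fact kn) -(bin_fact jn) !natrM fact_deg_exp_pow.
rewrite /deg_bell -/(bell_series lam x) -/(bell_series lam (- x)).
by rewrite -iter_fps_deriv; ring.
Qed.
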